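(* Let $k\ge1$. For any $\tau\in[0,r]$ and $n\ge0$, we have $$\mathbb E_\lambda[(\sigma_k(kr-\tau))^n]\le\big(\mathbb E[(N_{\lambda\tau})^n]\big)^{k-1}=O\big((\lambda\tau)^{(k-1)n}\big)$$ as $\lambda$ tends to infinity.
   Context: Fix $r>0$. Nodes form a Poisson point process on $[0,kr]$ with constant intensity $\lambda>0$. Additional nodes are placed at $0$ and at $t\in[0,kr]$; two nodes are connected if and only if their distance is at most $r$. $\sigma_k(t)$ is the number of $k$-hops from $0$ to $t$, i.e. the number of $(k-1)$-tuples of Poisson nodes $0<x_1<\cdots<x_{k-1}<t$ with $x_{i+1}-x_i\le r$ for $i=0,\ldots,k-1$, where $x_0:=0$, $x_k:=t$; in particular $\sigma_1(t)=1$ for $t\in[0,r]$. $\mathbb E_\lambda$ denotes expectation under intensity $\lambda$, and $N_{\lambda\tau}$ denotes a Poisson random variable with mean $\lambda\tau$. Here $f(\lambda)=O(g(\lambda))$ means that there exist $C>0$ and $\lambda_0>0$ (which may depend on $k,n,\tau,r$) such that $|f(\lambda)|\le C g(\lambda)$ for all $\lambda>\lambda_0$. Convention $0^0=1$. *)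

(* Defs.v *)
From HB Require Import structures.
From mathcomp Require Export all_boot all_order all_algebra finmap.
From mathcomp Require Export all_classical all_reals all_analysis.

Set Implicit Arguments.
Unset Strict Implicit.
Unset Printing Implicit Defensive.

Import Order.TTheory GRing.Theory Num.Theory.

Local Open Scope classical_set_scope.
Local Open Scope ring_scope.

(* The second argument of [poisson_prob] is not used by the library; for
   [rate = 0] the library sets [poisson_prob rate] to the Dirac mass at [0]. *)
Definition poisson_law {R : realType} (rate : R) : probability nat R :=
  poisson_prob rate 0%N.

(* [E[N ^ n]] where [N] is Poisson distributed with mean [rate]; [N] is the
   identity on [nat] endowed with its Poisson law. *)
Definition poisson_moment {R : realType} (rate : R) (n : nat) : \bar R :=
  ('E_(poisson_law rate)[fun N : nat => (N%:R ^+ n)%R])%E.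

(* Taking some of the [A i] to be [setT] gives the product rule for every
   subfamily. *)
Definition mutually_independent d (Omega : measurableType d) (R : realType)
    (P : probability Omega R) d' (T : measurableType d') (m : nat)
    (X : 'I_m -> Omega -> T) : Prop :=
  forall A : 'I_m -> set T, (forall i, measurable (A i)) ->
    P (\bigcap_i (X i @^-1` A i)) = (\prod_(i < m) P (X i @^-1` A i))%E.

Definition count_nodes {R : realType} (B : set R) (nodes : {fset R}) : nat :=
  #|` [fset x in nodes | x \in B]%fset|.

(* A Poisson point process on [[0, L]] is almost surely simple and finite, hence
   the encoding as a random finite set of nodes. *)
Record is_poisson_process d (Omega : measurableType d) (R : realType)
    (P : probability Omega R) (L lambda : R) (Phi : Omega -> {fset R}) : Prop :=
  {
    ppp_window : forall w x, x \in Phi w -> 0 <= x <= L ;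
    ppp_measurable : forall B : set R, measurable B -> B `<=` `[0, L] ->
      measurable_fun setT (fun w => count_nodes B (Phi w)) ;
    ppp_law : forall B : set R, measurable B -> B `<=` `[0, L] ->
      forall A : set nat, P [set w | A (count_nodes B (Phi w))] =
        poisson_law (lambda * fine (lebesgue_measure B)) A ;
    ppp_independent : forall (m : nat) (B : 'I_m -> set R),
      (forall i, measurable (B i)) -> (forall i, B i `<=` `[0, L]) ->
      trivIset setT B ->
      mutually_independent P (fun i w => count_nodes (B i) (Phi w))
  }.

(* [is_hop r t [:: x_1; ...; x_(k-1)]]: with [x_0 = 0] and [x_k = t],
   [0 < x_1 < ... < x_(k-1) < t] and [x_(i+1) - x_i <= r] for [0 <= i < k].
   The order condition bears on the intermediate nodes only: for [k = 1] it is
   void, so that the sole condition is [t <= r] (also when [t = 0]). *)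
Definition is_hop {R : realType} (r t : R) (x : seq R) : bool :=
  [&& path <%R 0 x, all (fun y => y < t) x &
      path (fun y z => z - y <= r) 0 (rcons x t)].

(* Meant for [0 < k]. *)
Definition sigma {R : realType} (r : R) (k : nat) (t : R) (nodes : {fset R}) :
    nat :=
  #|[pred x : k.-1.-tuple nodes | is_hop r t (map val x)]|.

Definition is_bigO_pinfty {R : realType} (f : R -> \bar R) (g : R -> R) : Prop :=
  exists C lambda0 : R, [/\ 0 < C, 0 < lambda0 &
    forall lambda, lambda0 < lambda -> (`|f lambda| <= (C * g lambda)%:E)%E].

(* Main.v *)
(* In a k-hop from 0 to kr - tau every step has length at most r, so the i-th
   intermediate node lies in [ir - tau, ir].  These k - 1 intervals have length
   tau and overlap at most in endpoints, which almost surely carry no node;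
   hence the number of k-hops is almost surely at most the product of the
   numbers of nodes in the disjoint intervals ]ir - tau, ir], and these are
   independent Poisson variables with mean lambda * tau.  For the asymptotics,
   E[N^(n+1)] = a E[(N+1)^n] for N Poisson with mean a, so E[N^n] = O(a^n) by
   induction on n. *)
Require Import Defs.
From mathcomp Require Import measurable_realfun ring lra.

Set Implicit Arguments.
Unset Strict Implicit.
Unset Printing Implicit Defensive.

Import Order.TTheory GRing.Theory Num.Theory.

Local Open Scope classical_set_scope.
Local Open Scope ring_scope.

(** * Integrals of functions of a variable with values in [nat] *)

(** For fixed [w] only the term [j = X w] of the series survives, and nonnegativity lets sum and
    integral be exchanged. Since [h] may depend on [w], the value of one variable can be fixed while
    the others stay under the integral. *)
Lemma integral_pick d (T : measurableType d) (R : realType)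
    (mu : {measure set T -> \bar R}) (X : T -> nat) (h : nat -> T -> R) :
  measurable_fun setT X -> (forall j, measurable_fun setT (h j)) ->
  (forall j w, 0 <= h j w) ->
  (\int[mu]_w (h (X w) w)%:E =
   \sum_(j <oo) \int[mu]_w (\1_[set j] (X w) * h j w)%:E)%E.
Proof.
move=> mX mh h0; rewrite -integral_nneseries//=; first last.
- by move=> j w _; rewrite lee_fin mulr_ge0.
- move=> j; apply/measurable_EFinP/measurable_funM => //.
  exact: measurableT_comp.
apply: eq_integral => w _; rewrite (@nneseriesD1 _ _ (X w))//; last first.
  by move=> j _; rewrite lee_fin mulr_ge0.
rewrite eseries0 ?adde0; first by rewrite indicE mem_set// mul1r.
by move=> j _ /andP[_ jX]; rewrite indicE memNset ?mul0r// => /= /esym/eqP;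
  apply/negP.
Qed.

Lemma integral_indic_preimage d d' (T : measurableType d)
    (T' : measurableType d') (R : realType) (mu : {measure set T -> \bar R})
    (X : T -> T') (A : set T') :
  measurable_fun setT X -> measurable A ->
  (\int[mu]_w (\1_A (X w) : R)%:E = mu (X @^-1` A))%E.
Proof.
move=> mX mA; rewrite -(setIT (X @^-1` A)) -integral_indic//.
by rewrite -[X in measurable X]setTI; exact: mX.
Qed.

Lemma integral_nat_valued d (T : measurableType d) (R : realType)
    (mu : {measure set T -> \bar R}) (X : T -> nat) (f : nat -> R) :
  measurable_fun setT X -> (forall j, 0 <= f j) ->
  (\int[mu]_w (f (X w))%:E =
   \sum_(j <oo) (f j)%:E * mu (X @^-1` [set j]))%E.
Proof.
move=> mX f0; rewrite (@integral_pick _ _ _ _ X (fun j _ => f j))//.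
apply: eq_eseriesr => j _; under eq_integral do rewrite mulrC EFinM.
rewrite ge0_integralZl_EFin ?integral_indic_preimage//.
by apply/measurable_EFinP; exact: measurableT_comp.
Qed.

(** * Expectation of a product of independent variables *)

Section independent_product.
Context d (Omega : measurableType d) (R : realType) (P : probability Omega R).
Context (m : nat) (X : 'I_m -> Omega -> nat).
Hypothesis mX : forall i, measurable_fun setT (X i).
Hypothesis indepX : mutually_independent P X.

Local Notation E f i := (\int[P]_w (f i (X i w))%:E)%E.

Let product_rule (f : 'I_m -> nat -> R) :=
  (\int[P]_w (\prod_(i < m) f i (X i w))%:E = \prod_(i < m) E f i)%E.

(** This is independence itself: a product of indicators is the indicator of the intersection of the
    events. *)
Let product_rule_indic (A : 'I_m -> set nat) :
  product_rule (fun i => \1_(A i)).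
Proof.
rewrite /product_rule; under [RHS]eq_bigr do rewrite integral_indic_preimage//.
rewrite -indepX// -[X in P X]setIT -integral_indic//; last first.
  apply: fin_bigcap_measurable => // i _.
  by rewrite -[X in measurable X]setTI; exact: mX.
apply: eq_integral => w _; congr EFin.
have [wA|wA] := pselect ((\bigcap_i (X i @^-1` A i)) w).
  rewrite [RHS]indicE mem_set// big1// => i _.
  by rewrite indicE mem_set//; exact: (wA i).
rewrite [RHS]indicE memNset//.
have [i wi] : exists i, ~ A i (X i w).
  by apply/existsNP => wi; apply: wA => i _; exact: wi.
by apply/eqP; rewrite prodf_seq_eq0; apply/hasP; exists i => //=;
  rewrite ?mem_index_enum// indicE memNset.
Qed.

(** The factor [f i0] is the sum over [j] of [f i0 j] times the indicator of [[set j]], and both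
    sides of the product rule are countably additive in that factor. *)
Let product_rule_step (f : 'I_m -> nat -> R) (i0 : 'I_m) :
  (forall i j, 0 <= f i j) -> (forall i, E f i \is a fin_num) ->
  (forall j, product_rule (fun i => if i == i0 then \1_[set j] else f i)) ->
  product_rule f.
Proof.
move=> f0 ffin fj; rewrite /product_rule.
set g := fun j i => if i == i0 then \1_[set j] else f i in fj.
have mf i : measurable_fun setT (fun w => f i (X i w)) by exact: measurableT_comp.
have gE j w : \prod_(i < m) g j i (X i w) =
    \1_[set j] (X i0 w) * \prod_(i < m | i != i0) f i (X i w).
  rewrite (bigD1 i0)//= /g eqxx; congr *%R.
  by apply: eq_bigr => i /negPf ->.
have -> : (\int[P]_w (\prod_(i < m) f i (X i w))%:E)%E =
    (\sum_(j <oo) (f i0 j)%:E * \int[P]_w (\prod_(i < m) g j i (X i w))%:E)%E.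
  under eq_integral => w _ do rewrite (bigD1 i0)//=.
  rewrite (@integral_pick _ _ _ _ (X i0)
    (fun j w => f i0 j * \prod_(i < m | i != i0) f i (X i w)))//; last 2 first.
  - move=> j; apply: measurable_funM => //.
    under eq_fun do rewrite big_mkcond/=; apply: measurable_prod => i _.
    by case: (i != i0).
  - by move=> j w; rewrite mulr_ge0// prodr_ge0.
  apply: eq_eseriesr => j _; rewrite -ge0_integralZl_EFin//.
  - by apply: eq_integral => w _; rewrite -EFinM gE mulrCA.
  - by move=> w _; rewrite lee_fin gE mulr_ge0// prodr_ge0.
  - apply/measurable_EFinP/measurable_prod => i _.
    by rewrite /g; case: ifP => // _; exact: measurableT_comp.
(* Finite expectations make the product of the other factors a real constant, which can be moved
   across the series. *)
pose K := (\prod_(i < m | i != i0) fine (E f i))%R.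
have KE : (\prod_(i < m | i != i0) E f i)%E = K%:E.
  by rewrite -prodEFin; apply: eq_bigr => i _; rewrite fineK.
under eq_eseriesr => j _.
  rewrite fj (bigD1 i0)//= /g eqxx integral_indic_preimage//.
  rewrite (eq_bigr (fun i => E f i)); last by move=> i /negPf ->.
  rewrite KE muleA muleC; over.
rewrite nneseriesZl; last first.
  by move=> j _; rewrite mule_ge0// lee_fin.
by rewrite -integral_nat_valued// muleC [RHS](bigD1 i0)//= KE.
Qed.

(* Factors are replaced one at a time by indicators of singletons, by
   conditioning on the value of the corresponding variable. *)
Lemma integral_prod_independent (f : 'I_m -> nat -> R) :
  (forall i j, 0 <= f i j) -> (forall i, E f i \is a fin_num) ->
  (\int[P]_w (\prod_(i < m) f i (X i w))%:E = \prod_(i < m) E f i)%E.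
Proof.
(* Induction on [s], where only the factors of index below [s] may fail to be indicators; for
   [s = m] this constraint is void. *)
move=> f0 ffin; suff Q s : forall g : 'I_m -> nat -> R,
    (forall i j, 0 <= g i j) -> (forall i, E g i \is a fin_num) ->
    (forall i : 'I_m, (s <= i)%N -> exists A, g i = \1_A) -> product_rule g.
  apply: (Q m) => // i; by rewrite leqNgt ltn_ord.
elim: s => [|s IH] g g0 gfin gA.
  have /choice[A gE] : forall i, exists A : set nat, g i = \1_A.
    by move=> i; exact: gA.
  by rewrite (_ : g = fun i => \1_(A i)) //; apply/funext.
have [sm|ms] := ltnP s m; last first.
  by apply: IH => // i si; case/negP: (ltn_geF (leq_ltn_trans si (ltn_ord i))).
apply: (@product_rule_step g (Ordinal sm)) => // j; apply: IH.
- by move=> i l; case: ifP.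
- move=> i; case: ifP => // _; rewrite integral_indic_preimage//.
  apply: fin_num_measure.
  by rewrite -[X in measurable X]setTI; exact: mX.
- move=> i si; case: ifPn => [_|/eqP i0]; first by exists [set j].
  apply: gA; rewrite ltn_neqAle si andbT; apply/eqP => si'.
  by apply: i0; exact/val_inj.
Qed.

End independent_product.

(* [integral] is a supremum of integrals of simple functions below the
   integrand, so no measurability of [f] is needed. *)
Lemma ge0_ae_le_integral_measurable_r d (T : measurableType d) (R : realType)
    (mu : {measure set T -> \bar R}) (f g : T -> \bar R) (N : set T) :
  (forall w, 0 <= f w)%E -> (forall w, 0 <= g w)%E -> measurable_fun setT g ->
  measurable N -> mu N = 0%E -> (forall w, ~ N w -> f w <= g w)%E ->
  (\int[mu]_w f w <= \int[mu]_w g w)%E.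
Proof.
move=> f0 g0 mg mN N0 fg.
(* Raising [g] to [+oo] on the null set keeps its integral and makes it dominate [f] everywhere, so
   every simple function below [f] is below [g']. *)
pose g' w := if w \in N then +oo%E else g w.
have g'0 w : (0 <= g' w)%E by rewrite /g'; case: ifP.
have mg' : measurable_fun setT g'.
  apply: measurable_fun_ifT => //; apply: (measurable_fun_bool true).
  by rewrite setTI (_ : _ @^-1` _ = N)//; apply/seteqP;
    split=> w /=; [exact: set_mem|exact: mem_set].
have -> : (\int[mu]_w g w = \int[mu]_w g' w)%E.
  apply: ge0_ae_eq_integral => //; exists N; split => // w /=.
  apply: contra_notP => wN _; rewrite /g' ifF//.
  by apply/negbTE; rewrite notin_setE.
rewrite !ge0_integralTE//; apply: le_ereal_sup => _ [h hf <-] /=.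
exists h => // w; rewrite /g'; case: ifPn => wN; first by rewrite leey.
by rewrite (le_trans (hf w))// fg//; rewrite -notin_setE.
Qed.

(** * Pathwise bound on the number of hops *)

Lemma count_nodesE (R : realType) (B : set R) (nodes : {fset R}) :
  count_nodes B nodes = #|[pred y : nodes | val y \in B]|.
Proof.
by rewrite /count_nodes card_fset_sum1 -big_fset_condE/= big_seq_fsetE sum1_card.
Qed.

Lemma path_step_le_nth (R : realType) (r x0 : R) (s : seq R) (i j : nat) :
  path (fun y z => z - y <= r) x0 s -> (i <= j <= size s)%N ->
  nth 0 (x0 :: s) j - nth 0 (x0 :: s) i <= (j - i)%:R * r.
Proof.
move=> /(pathP 0) xs /andP[]; elim: j => [|j IH].
  by rewrite leqn0 => /eqP -> _; rewrite subrr mul0r.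
rewrite leq_eqVlt => /predU1P[-> _|ij js]; first by rewrite subrr subnn mul0r.
have := IH ij (ltnW js); have := xs j js; rewrite subSn// -natr1 mulrDl mul1r /=.
lra.
Qed.

Lemma hop_node_itv (R : realType) (r tau : R) (m : nat) (x : seq R) (i : nat) :
  size x = m -> (i < m)%N -> is_hop r (m.+1%:R * r - tau) x ->
  i.+1%:R * r - tau <= nth 0 x i <= i.+1%:R * r.
Proof.
move=> xm im /and3P[_ _ steps].
(* Entry [i] of [x] is the node reached after [i.+1] steps. The [m - i] steps left to the target
   bound it from below; the steps already made from [0] bound it from above. *)
have := path_step_le_nth (i := i.+1) (j := m.+1) steps.
have := path_step_le_nth (i := 0) (j := i.+1) steps.
rewrite size_rcons xm /= !ltnS (ltnW im) leqnn => /(_ isT) + /(_ isT).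
rewrite !nth_rcons xm ltnn eqxx im subr0 subSS subn0 natrB 1?ltnW//.
rewrite -!natr1; nra.
Qed.

(** Open on the left so that consecutive intervals stay disjoint even for [tau = r]. *)
Definition hop_itv (R : realType) (r tau : R) (i : nat) : set R :=
  `]i.+1%:R * r - tau, i.+1%:R * r]%classic.

Lemma sigma_le_prod_count (R : realType) (r tau : R) (m : nat)
    (nodes : {fset R}) :
  count_nodes (range (fun i : 'I_m => i.+1%:R * r - tau)) nodes = 0%N ->
  (sigma r m.+1 (m.+1%:R * r - tau) nodes <=
   \prod_(i < m) count_nodes (hop_itv r tau i) nodes)%N.
Proof.
move=> endpoint0.
under eq_bigr do rewrite count_nodesE.
pose F (i : 'I_m) := [pred y : nodes | val y \in hop_itv r tau i].
have -> : (\prod_(i < m) #|[pred y : nodes | val y \in hop_itv r tau i]| =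
    #|family F|)%N.
  (* The product counts the choices of one node in each interval; a hop is such a choice, and its
     tuple determines it. *)
  by rewrite card_family foldrE big_map enumT.
pose h (x : m.-tuple nodes) : {ffun 'I_m -> nodes} := [ffun i => tnth x i].
have hinj : injective h.
  by move=> x y /ffunP xy; apply: eq_from_tnth => i; have := xy i; rewrite !ffunE.
rewrite /sigma/= -(fintype.card_image hinj); apply/subset_leq_card/fintype.subsetP.
move=> y /fintype.imageP[/= x hx ->]; apply/familyP => i; rewrite ffunE inE.
have size_x : size (map val x) = m by rewrite size_map size_tuple.
have := hop_node_itv size_x (ltn_ord i) hx.
rewrite (nth_map (tnth x i)) ?size_tuple// -tnth_nth => /andP[lex xle].
rewrite /hop_itv /= in_itv/= xle andbT lt_neqAle lex andbT.
(* A node at the excluded left end would contradict [endpoint0]. *)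
apply/eqP => xE; move/eqP: endpoint0; rewrite count_nodesE.
apply/negP; rewrite -lt0n; apply/card_gt0P; exists (tnth x i).
by rewrite !inE; exists i.
Qed.

(** * Growth of Poisson moments *)

Lemma poisson_moment_series (R : realType) (a : R) (n : nat) : 0 < a ->
  poisson_moment a n = (\sum_(j <oo) (j%:R ^+ n * poisson_pmf a j)%:E)%E.
Proof.
move=> a0; rewrite /poisson_moment unlock.
rewrite (@integral_nat_valued _ nat R (poisson_law a) id (fun j => j%:R ^+ n))//.
  apply: eq_eseriesr => j _; rewrite EFinM; congr (_ * _)%E.
  by rewrite /poisson_law /= /poisson_prob /= a0 esum_set1// lee_fin poisson_pmf_ge0.
Qed.

Lemma poisson_moment0 (R : realType) (n : nat) :
  poisson_moment (0 : R) n = ((0 : R) ^+ n)%:E.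
Proof.
rewrite /poisson_moment unlock.
rewrite (eq_measure_integral (\d_0%N : {measure set nat -> \bar R})).
  by rewrite integral_dirac//= diracT mul1e.
by move=> A _ _; rewrite /poisson_law /= /poisson_prob /= ltxx.
Qed.

Lemma poisson_pmfS (R : realType) (a : R) (j : nat) : 0 < a ->
  j.+1%:R * poisson_pmf a j.+1 = a * poisson_pmf a j.
Proof.
move=> a0; rewrite /poisson_pmf a0 factS natrM exprS invfM.
by field; rewrite nat1r !pnatr_eq0 -lt0n fact_gt0.
Qed.

(** For [j >= 1] one has [j + 1 <= 2 * j]; the summand [1] covers [j = 0]. *)
Lemma exprS_nat_le (R : realType) (j n : nat) :
  (j.+1%:R ^+ n <= 2 ^+ n * j%:R ^+ n + 1 :> R).
Proof.
case: j => [|j]; first by rewrite expr1n lerDr mulr_ge0// exprn_ge0.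
rewrite -exprMn -[leLHS]addr0 lerD// lerXn2r ?nnegrE ?mulr_ge0//.
by rewrite -natrM ler_nat mul2n -addnn addSn addnS !ltnS leq_addr.
Qed.

Lemma poisson_moment_exp0 (R : realType) (a : R) :
  poisson_moment a 0 = 1%E.
Proof.
rewrite /poisson_moment unlock; under eq_integral do rewrite expr0.
by rewrite integral_cst//= mul1e probability_setT.
Qed.

(* From [E[N^(n+1)] = a E[(N+1)^n]], which is the shift [poisson_pmfS]. *)
Lemma poisson_momentS_le (R : realType) (a : R) (n : nat) : 0 < a ->
  (poisson_moment a n.+1 <= a%:E * ((2 ^+ n)%:E * poisson_moment a n + 1))%E.
Proof.
move=> a0; have pge0 j p : (0 <= (j%:R ^+ p * poisson_pmf a j)%:E)%E.
  by rewrite lee_fin mulr_ge0 ?exprn_ge0 ?poisson_pmf_ge0.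
rewrite -(poisson_moment_exp0 a) !poisson_moment_series//.
rewrite -nneseriesZl// -nneseriesD//; last first.
  by move=> j _ _; rewrite mule_ge0// lee_fin.
rewrite -nneseriesZl; last by move=> j _; rewrite adde_ge0// mule_ge0// lee_fin.
(* The term at [0] vanishes because the exponent is positive, so the series may be shifted by one
   and compared termwise. *)
rewrite nneseries_recl// expr0n mul0r add0e -nneseries_addn//.
apply: lee_nneseries => [j _ _|j _]; first exact: pge0.
rewrite -[leRHS]/((a * (2 ^+ n * (j%:R ^+ n * poisson_pmf a j) +
  j%:R ^+ 0 * poisson_pmf a j))%:E) lee_fin addn1 exprS.
rewrite [leLHS]mulrAC poisson_pmfS// -mulrA expr0.
rewrite ler_wpM2l ?(ltW a0)// mulrA -mulrDl [leLHS]mulrC.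
by rewrite ler_wpM2r ?poisson_pmf_ge0// exprS_nat_le.
Qed.

(** The maximum with [1] gives one bound for all [a > 0]: for small [a] the positive moments are of
    order [a] rather than [a ^+ n]. *)
Lemma poisson_moment_le (R : realType) (n : nat) : exists2 C : R, 0 < C &
  forall a, 0 < a -> (poisson_moment a n <= (C * Num.max 1 a ^+ n)%:E)%E.
Proof.
elim: n => [|n [C C0 IH]].
  by exists 1 => // a a0; rewrite poisson_moment_exp0 expr0 mul1r.
(* The final [1] absorbs the additive [1] of the recursion, since [b ^+ n >= 1]. *)
exists (2 ^+ n * C + 1) => [|a a0];
  first by rewrite addr_gt0// mulr_gt0// exprn_gt0.
apply: (le_trans (poisson_momentS_le n a0)).
set b := Num.max 1 a.
have b1 : 1 <= b by rewrite le_max lexx.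
have ab : a <= b by rewrite le_max lexx orbT.
apply: (@le_trans _ _ (a%:E * ((2 ^+ n)%:E * (C * b ^+ n)%:E + 1))%E).
  by rewrite lee_pmul2l// leeD2r// lee_pmul2l ?IH// lte_fin exprn_gt0.
rewrite -[leLHS]/((a * (2 ^+ n * (C * b ^+ n) + 1))%:E) lee_fin exprS [leRHS]mulrCA.
have b_ge0 := le_trans ler01 b1.
apply: ler_pM => //; first exact: ltW.
  by rewrite addr_ge0// !mulr_ge0 ?exprn_ge0 ?(ltW C0).
by rewrite mulrDl mul1r mulrA lerD2l exprn_ege1.
Qed.

Lemma poisson_moment_ge0 (R : realType) (a : R) (n : nat) :
  (0 <= poisson_moment a n)%E.
Proof.
by rewrite /poisson_moment expectation_ge0// => j; rewrite exprn_ge0.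
Qed.

Lemma poisson_moment_fin_num (R : realType) (a : R) (n : nat) :
  0 <= a -> poisson_moment a n \is a fin_num.
Proof.
rewrite le_eqVlt => /predU1P[<-|a0]; first by rewrite poisson_moment0.
have [C _ /(_ a a0) le_moment] := poisson_moment_le R n.
by rewrite ge0_fin_numE ?poisson_moment_ge0// (le_lt_trans le_moment) ?ltry.
Qed.

Lemma poisson_moment_bigO (R : realType) (tau : R) (m n : nat) : 0 <= tau ->
  is_bigO_pinfty (fun lambda => poisson_moment (lambda * tau) n ^+ m)%E
    (fun lambda => (lambda * tau) ^+ (m * n)).
Proof.
rewrite le_eqVlt => /predU1P[<-|tau0].
  (* For [tau = 0] the law is the Dirac mass at [0], and both sides are the same power of [0], equal
     to [1] for exponent [0]. *)
  exists 1, 1; split => // lambda _; rewrite mulr0 poisson_moment0.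
  by rewrite -EFin_expe -exprM mul1r mulnC abse_EFin lee_fin ger0_norm// exprn_ge0.
have [C C0 le_moment] := poisson_moment_le R n.
(* Beyond [tau^-1] the mean [lambda * tau] exceeds [1], so the maximum is the mean itself. *)
exists (C ^+ m), tau^-1; rewrite exprn_gt0// invr_gt0 tau0.
split => // lambda; rewrite -div1r ltr_pdivrMr// => lt1.
have gt0 := lt_trans ltr01 lt1.
have moment_fin := poisson_moment_fin_num n (ltW gt0).
have := le_moment _ gt0; rewrite (max_idPr (ltW lt1)).
rewrite -(fineK moment_fin) -EFin_expe abse_EFin !lee_fin => le_n.
have moment_ge0 : 0 <= fine (poisson_moment (lambda * tau) n).
  by rewrite fine_ge0// poisson_moment_ge0.
rewrite ger0_norm ?exprn_ge0// mulnC exprM -exprMn.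
by rewrite lerXn2r// nnegrE (le_trans moment_ge0).
Qed.

(** * From the pathwise bound to the expectation *)

Section expectation_sigma.
Context d (Omega : measurableType d) (R : realType) (P : probability Omega R).
Context (r tau lambda : R) (m : nat) (Phi : Omega -> {fset R}).
Hypothesis r_gt0 : 0 < r.
Hypothesis tau_bounds : 0 <= tau <= r.
Hypothesis lambda_gt0 : 0 < lambda.
Hypothesis ppp : is_poisson_process P (m.+1%:R * r) lambda Phi.

Let tau_ge0 : 0 <= tau. Proof. by case/andP: tau_bounds. Qed.

Let endpoint (i : 'I_m) : R := i.+1%:R * r - tau.

Let endpoint_ge0 i : 0 <= endpoint i.
Proof.
have /andP[_ taur] := tau_bounds.
by rewrite subr_ge0 (le_trans taur)// ler_peMl// ?ler1n// ltW.
Qed.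

Let endpoint_le (i : 'I_m) : i.+1%:R * r <= m.+1%:R * r.
Proof. by rewrite ler_pM2r// ler_nat ltnS ltnW. Qed.

Let N := [set w | count_nodes (range endpoint) (Phi w) <> 0%N].

Let endpoints_window : range endpoint `<=` `[0, m.+1%:R * r].
Proof.
move=> _ [i _ <-]; rewrite /= in_itv/= endpoint_ge0 (le_trans _ (endpoint_le i))//.
by rewrite lerBlDr lerDl.
Qed.

Let countable_endpoints : countable (range endpoint).
Proof. exact/finite_set_countable/finite_image/finite_finset. Qed.

Let measurable_endpoints : measurable (range endpoint).
Proof. exact: countable_measurable. Qed.

Let measurable_endpoint_event : measurable N.
Proof.
rewrite -[N]setTI.
exact: (ppp_measurable ppp measurable_endpoints endpoints_window measurableT
  (Y := [set j | j <> 0%N])).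
Qed.

(** The endpoints form a Lebesgue null set, so the count there is Poisson of rate [0], that is, the
    Dirac mass at [0]. *)
Let endpoint_event0 : P N = 0%E.
Proof.
rewrite (ppp_law ppp measurable_endpoints endpoints_window (fun j => j <> 0%N)).
rewrite countable_lebesgue_measure0// mulr0.
by rewrite /poisson_law /= /poisson_prob /= ltxx diracE memNset.
Qed.

Let measurable_hop_itv i : measurable (hop_itv r tau i).
Proof. exact: measurable_itv. Qed.

Let hop_itv_window (i : 'I_m) : hop_itv r tau i `<=` `[0, m.+1%:R * r].
Proof.
move=> x; rewrite /hop_itv /= !in_itv/= => /andP[lx xl].
by rewrite (le_trans (endpoint_ge0 i) (ltW lx)) (le_trans xl).
Qed.

(** For [i < j], [tau <= r] puts the right end of interval [i] at or before the left end of interval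
    [j], which is excluded. *)
Let trivIset_hop_itv : trivIset setT (fun i : 'I_m => hop_itv r tau i).
Proof.
suff lt_disj (i j : 'I_m) x : (i < j)%N ->
    hop_itv r tau i x -> hop_itv r tau j x -> False.
  apply/trivIsetP => i j _ _ ij; rewrite -subset0 => x [ix jx].
  case: (ltngtP i j) => [lij|lij|/val_inj/eqP]; last exact/negP.
  - exact: lt_disj lij ix jx.
  - exact: lt_disj lij jx ix.
rewrite /hop_itv /= !in_itv/= => ij /andP[_ xi] /andP[jx _].
have ji : i.+1%:R * r <= j%:R * r by rewrite ler_pM2r// ler_nat.
have /andP[_ taur] := tau_bounds.
by move: jx; rewrite -natr1; lra.
Qed.

Let X (i : 'I_m) w := count_nodes (hop_itv r tau i) (Phi w).

Let mX i : measurable_fun setT (X i).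
Proof. exact: (ppp_measurable ppp). Qed.

Let integral_count_exp i n :
  (\int[P]_w ((X i w)%:R ^+ n)%:E)%E = poisson_moment (lambda * tau) n.
Proof.
rewrite (@integral_nat_valued _ _ _ P (X i) (fun j => j%:R ^+ n))//.
rewrite /poisson_moment expectation.unlock.
rewrite (@integral_nat_valued _ nat R (poisson_law (lambda * tau)) id
  (fun j => j%:R ^+ n))//.
apply: eq_eseriesr => j _; congr (_ * _)%E.
transitivity (poisson_law (lambda * fine (lebesgue_measure (hop_itv r tau i)))
    [set j]).
  exact: (ppp_law ppp (measurable_hop_itv i) (hop_itv_window (i := i))).
rewrite lebesgue_measure_itv/= lte_fin.
(* If [tau = 0] the interval is empty and its measure [0] is again [tau]. *)
have [lt|] := ltP; first by rewrite -EFinD/= opprB addrC subrK.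
by rewrite lerBrDr gerDl => tau_le0; rewrite (_ : tau = 0)//; apply/le_anti/andP.
Qed.

Lemma expectation_sigma_le n :
  ('E_P[fun w => ((sigma r m.+1 (m.+1%:R * r - tau) (Phi w))%:R ^+ n)%R]
    <= poisson_moment (lambda * tau) n ^+ m)%E.
Proof.
rewrite expectation.unlock.
(* Independence turns the power of the moment into the expectation of a product of counts, leaving a
   pointwise comparison outside [N]. *)
have -> : (poisson_moment (lambda * tau) n ^+ m =
    \int[P]_w (\prod_(i < m) ((X i w)%:R ^+ n))%:E)%E.
  rewrite (@integral_prod_independent _ _ _ P m X _ _ (fun _ j => j%:R ^+ n))//.
  - under eq_bigr do rewrite integral_count_exp.
    by rewrite big_const_ord -Monoid.iteropE.
  - exact: (ppp_independent ppp).
  - by move=> i; rewrite integral_count_exp poisson_moment_fin_num// mulr_ge0// ltW.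
apply: (ge0_ae_le_integral_measurable_r (N := N)) => //.
- by move=> w; rewrite lee_fin prodr_ge0// => i _; rewrite exprn_ge0.
- apply/measurable_EFinP/measurable_prod => i _.
  exact: (measurableT_comp (f := fun j : nat => j%:R ^+ n : R)).
- move=> w /contrapT/sigma_le_prod_count le_sigma.
  rewrite lee_fin prodrXl lerXn2r ?nnegrE ?prodr_ge0//.
  by rewrite -natr_prod ler_nat.
Qed.

End expectation_sigma.

Theorem proposition7p1 (R : realType) (r : R) (k : nat) (tau : R) (n : nat)
    (r_gt0 : 0 < r) (k_ge1 : (1 <= k)%N) (tau_bounds : 0 <= tau <= r) :
  (forall (lambda : R) (lambda_gt0 : 0 < lambda)
      (d : measure_display) (Omega : measurableType d)
      (P : probability Omega R) (Phi : Omega -> {fset R}),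
    is_poisson_process P (k%:R * r) lambda Phi ->
    ('E_P[fun w => ((sigma r k (k%:R * r - tau) (Phi w))%:R ^+ n)%R]
      <= poisson_moment (lambda * tau) n ^+ (k - 1))%E)
  /\
  is_bigO_pinfty
    (fun lambda => (poisson_moment (lambda * tau) n ^+ (k - 1))%E)
    (fun lambda => (lambda * tau) ^+ ((k - 1) * n)).
Proof.
split; last by apply: poisson_moment_bigO; case/andP: tau_bounds.
case: k k_ge1 => // m _ lambda lambda_gt0 d Omega P Phi ppp; rewrite subn1.
exact: expectation_sigma_le.
Qed.
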